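(* Let $f, f^\nu:\mathbb{R}^m\times\mathbb{R}^n\to\overline{\mathbb{R}}$, $\nu\in\mathbb{N}$, be Rockafellians (for functions $\phi,\phi^\nu:\mathbb{R}^n\to\overline{\mathbb{R}}$, respectively). Then: (a) If $f^\nu$ epi-converges to $f$ and $y^\nu\to y\in\mathbb{R}^m$, then $f^\nu_{y^\nu}$ epi-converges to $f_y$. (b) (For a fixed $\nu$.) If $\operatorname{epi} f$ and $\operatorname{epi} f^\nu$ are nonempty, $\rho\in[0,\infty)$, $y,y^\nu\in\mathbb{R}^m$, and $\bar\rho\ge\rho(1+\max\{\|y\|_2,\|y^\nu\|_2\})$, then $$\hat d_\rho(\operatorname{epi} f_y,\operatorname{epi} f^\nu_{y^\nu})\le\big(1+\max\{\|y\|_2,\|y^\nu\|_2\}\big)\,\hat d_{\bar\rho}(\operatorname{epi} f,\operatorname{epi} f^\nu)+\rho\|y-y^\nu\|_2,$$ where the norm on $\mathbb{R}^m\times\mathbb{R}^n\times\mathbb{R}$ is $(u,x,\alpha)\mapsto\max\{\|u\|_2,\|x\|_2,|\alpha|\}$.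
   Context: $\overline{\mathbb{R}}=[-\infty,\infty]$ and $\mathbb{N}=\{1,2,\dots\}$. A function $f:\mathbb{R}^m\times\mathbb{R}^n\to\overline{\mathbb{R}}$ is a Rockafellian for $g:\mathbb{R}^n\to\overline{\mathbb{R}}$ when $f(0,x)=g(x)$ for all $x\in\mathbb{R}^n$. Tilted Rockafellians: $f_y(u,x)=f(u,x)-\langle y,u\rangle$ and $f^\nu_{y}(u,x)=f^\nu(u,x)-\langle y,u\rangle$ for $y\in\mathbb{R}^m$. Epi-convergence: $g^\nu:\mathbb{R}^d\to\overline{\mathbb{R}}$ epi-converge to $g:\mathbb{R}^d\to\overline{\mathbb{R}}$ when (i) $\liminf g^\nu(x^\nu)\ge g(x)$ whenever $x^\nu\to x$, and (ii) for every $x$ there is $x^\nu\to x$ with $\limsup g^\nu(x^\nu)\le g(x)$. The epigraph is $\operatorname{epi} g=\{(x,\alpha)\in\mathbb{R}^d\times\mathbb{R}\mid g(x)\le\alpha\}$. Truncated Hausdorff distance: given a norm on the ambient space, $\mathbb{B}(\rho)=\{x\mid\|x\|\le\rho\}$; the excess is $\operatorname{exs}(C;D)=\sup_{x\in C}\inf_{y\in D}\|x-y\|$ if $C,D$ are nonempty, $\operatorname{exs}(C;\emptyset)=\infty$ if $C\ne\emptyset$, and $\operatorname{exs}(\emptyset;D)=0$ for every $D$; and $\hat d_\rho(C,D)=\max\{\operatorname{exs}(C\cap\mathbb{B}(\rho);D),\ \operatorname{exs}(D\cap\mathbb{B}(\rho);C)\}$ for $\rho\ge0$. *)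

(* Defs.v *)
From mathcomp Require Import all_boot all_order all_algebra.
From mathcomp Require Import all_classical all_reals all_analysis.

Set Implicit Arguments.
Unset Strict Implicit.
Unset Printing Implicit Defensive.

Import Order.TTheory GRing.Theory Num.Theory.
Import numFieldNormedType.Exports.

Local Open Scope classical_set_scope.
Local Open Scope ring_scope.

Definition dot (R : realType) (d : nat) (y u : 'rV[R]_d) : R :=
  \sum_(i < d) y 0 i * u 0 i.

(* The library norm `|_| on row vectors is the max norm, so the Euclidean norm
   is defined separately; both induce the library topology of 'rV[R]_d. *)
Definition norm2 (R : realType) (d : nat) (u : 'rV[R]_d) : R :=
  Num.sqrt (\sum_(i < d) u 0 i ^+ 2).

Definition rockafellian (R : realType) (m n : nat)
    (f : 'rV[R]_m * 'rV[R]_n -> \bar R) (g : 'rV[R]_n -> \bar R) : Prop :=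
  forall x : 'rV[R]_n, f (0, x) = g x.

Definition tilt (R : realType) (m n : nat) (y : 'rV[R]_m)
    (f : 'rV[R]_m * 'rV[R]_n -> \bar R) : 'rV[R]_m * 'rV[R]_n -> \bar R :=
  fun p => (f p - (dot y p.1)%:E)%E.

Definition epi_cvg (R : realType) (T : pseudoMetricType R)
    (g_ : nat -> T -> \bar R) (g : T -> \bar R) : Prop :=
  (forall (x : T) (x_ : nat -> T), x_ @ \oo --> x ->
     (g x <= limn_einf (fun k => g_ k (x_ k)))%E) /\
  (forall x : T, exists x_ : nat -> T, x_ @ \oo --> x /\
     (limn_esup (fun k => g_ k (x_ k)) <= g x)%E).

Definition epi (R : realType) (T : Type) (g : T -> \bar R) : set (T * R) :=
  [set p | (g p.1 <= p.2%:E)%E].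

Section TruncatedHausdorff.
Variables (R : realType) (V : zmodType) (N : V -> R).
Implicit Types C D : set V.

Definition nball (rho : R) : set V := [set x | N x <= rho].

Definition exs C D : \bar R :=
  if C == set0 then 0%:E
  else if D == set0 then +oo%E
  else ereal_sup [set ereal_inf [set (N (x - y))%:E | y in D] | x in C].

Definition dhat (rho : R) C D : \bar R :=
  Order.max (exs (C `&` nball rho) D) (exs (D `&` nball rho) C).

End TruncatedHausdorff.

Definition epi_norm (R : realType) (m n : nat)
    (p : 'rV[R]_m * 'rV[R]_n * R) : R :=
  Num.max (Num.max (norm2 p.1.1) (norm2 p.1.2)) `|p.2|.

(* Main.v *)
(* For (a), the tilt perturbs the values by a convergent real sequence
   -<y_k, u_k>, and such a perturbation shifts liminf and limsup by its limit.

   For (b), the shear (u, x, a) |-> (u, x, a + <y, u>) carries the epigraph of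
   the tilted function f_y into that of f and, by Cauchy-Schwarz, the ball of
   radius rho into the ball of radius rho (1 + |y|). Approximating the image in
   the epigraph of f_k and shearing back with y_k instead of y costs a factor
   1 + |y_k| on the distance plus |<y - y_k, u>| <= rho |y - y_k|. *)

Require Import Defs.
From mathcomp Require Import all_boot all_order all_algebra.
From mathcomp Require Import all_classical all_reals all_analysis.
From mathcomp Require Import ring lra.

Import Order.TTheory GRing.Theory Num.Theory.
Import numFieldNormedType.Exports.

Local Open Scope classical_set_scope.
Local Open Scope ring_scope.

Lemma dot_sqr_le (R : realType) (d : nat) (y u : 'rV[R]_d) :
  dot y u ^+ 2 <= (\sum_(i < d) y 0 i ^+ 2) * (\sum_(i < d) u 0 i ^+ 2).
Proof.
set A := \sum_(i < d) y 0 i ^+ 2; set B := \sum_(i < d) u 0 i ^+ 2.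
suff : 0 <= A * B + B * A - 2 * (dot y u * dot y u) by rewrite expr2; lra.
(* Lagrange's identity *)
have -> : A * B + B * A - 2 * (dot y u * dot y u) =
    \sum_(i < d) \sum_(j < d) (y 0 i * u 0 j - y 0 j * u 0 i) ^+ 2.
  rewrite /A /B /dot !big_distrlr /= mulr_sumr -big_split -sumrB /=.
  apply: eq_bigr => i _; rewrite mulr_sumr -big_split -sumrB /=.
  by apply: eq_bigr => j _; ring.
by apply: sumr_ge0 => i _; apply: sumr_ge0 => j _; exact: sqr_ge0.
Qed.

Lemma norm2_ge0 (R : realType) (d : nat) (u : 'rV[R]_d) : 0 <= norm2 u.
Proof. exact: sqrtr_ge0. Qed.

Lemma norm2N (R : realType) (d : nat) (u : 'rV[R]_d) : norm2 (- u) = norm2 u.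
Proof.
by rewrite /norm2; congr Num.sqrt; apply: eq_bigr => i _; rewrite mxE sqrrN.
Qed.

Lemma normr_dot_le (R : realType) (d : nat) (y u : 'rV[R]_d) :
  `|dot y u| <= norm2 y * norm2 u.
Proof.
have A0 (v : 'rV[R]_d) : 0 <= \sum_(i < d) v 0 i ^+ 2.
  by apply: sumr_ge0 => i _; exact: sqr_ge0.
by rewrite /norm2 -sqrtrM // -sqrtr_sqr ler_wsqrtr // dot_sqr_le.
Qed.

Lemma dotBr (R : realType) (d : nat) (y u v : 'rV[R]_d) :
  dot y (u - v) = dot y u - dot y v.
Proof. by rewrite /dot -sumrB; apply: eq_bigr => i _; rewrite !mxE mulrBr. Qed.

Lemma dotBl (R : realType) (d : nat) (y z u : 'rV[R]_d) :
  dot (y - z) u = dot y u - dot z u.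
Proof. by rewrite /dot -sumrB; apply: eq_bigr => i _; rewrite !mxE mulrBl. Qed.

Lemma cvg_dot (R : realType) (d : nat) (y_ u_ : nat -> 'rV[R]_d)
    (y u : 'rV[R]_d) :
  y_ @ \oo --> y -> u_ @ \oo --> u -> dot (y_ k) (u_ k) @[k --> \oo] --> dot y u.
Proof.
move=> yy uu.
have coord (w_ : nat -> 'rV[R]_d) (w : 'rV[R]_d) i :
    w_ @ \oo --> w -> w_ k 0 i @[k --> \oo] --> w 0 i.
  move=> ww; exact: (cvg_comp _ _ ww (@coord_continuous R 1 d 0 i w)).
rewrite /dot; apply: cvg_big => [|i _]; first exact: add_continuous.
by apply: cvgM; exact: coord.
Qed.

(** The limsup is an infimum, over sets [V] of the filter, of suprema on [V]. Intersecting [V] with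
    the indices where [b_ k] is within [e] of [b] stays in the filter, and there the sum exceeds
    [u k] by at most [b + e]. *)
Lemma limn_esupD_le (R : realType) (u : nat -> \bar R) (b_ : nat -> R) (b : R) :
  b_ @ \oo --> b ->
  (limn_esup (fun k => u k + (b_ k)%:E) <= limn_esup u + b%:E)%E.
Proof.
move=> bb; apply/lee_addgt0Pr => e e0.
rewrite -addeA -EFinD -leeBlDr//; rewrite [X in (_ <= X)%E]limf_esupE.
apply: le_ereal_inf_tmp => _ [V oV <-]; rewrite leeBlDr//.
rewrite /limn_esup limf_esupE; apply: ge_ereal_inf.
pose W := [set k | `|b - b_ k| <= e].
have oW : \oo W by exact: (cvgr_dist_le _ _ bb _ e0).
exists (ereal_sup [set (u k + (b_ k)%:E)%E | k in V `&` W]).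
  by exists (V `&` W) => //; exact: filterI.
apply: ge_ereal_sup => _ [k [Vk Wk] <-]; apply: leeD.
  by apply: ereal_sup_ubound; exists k.
rewrite lee_fin; move: Wk; rewrite /W /= ler_norml => /andP[h1 h2]; lra.
Qed.

(** Dual to the limsup bound: the liminf is minus the limsup of the negation, and negation
    distributes over these sums because the perturbations are real. *)
Lemma limn_einfD_ge (R : realType) (u : nat -> \bar R) (b_ : nat -> R) (b : R) :
  b_ @ \oo --> b ->
  (limn_einf u + b%:E <= limn_einf (fun k => u k + (b_ k)%:E))%E.
Proof.
move=> bb; rewrite /limn_einf leeNr fin_num_oppeD// oppeK.
under [X in limn_esup X]eq_fun do rewrite fin_num_oppeD// -EFinN.
exact: (limn_esupD_le _ _ _ _ (cvgN bb)).
Qed.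

Lemma epi_cvg_tilt (R : realType) (m n : nat)
    (f : 'rV[R]_m * 'rV[R]_n -> \bar R)
    (f_ : nat -> 'rV[R]_m * 'rV[R]_n -> \bar R)
    (y : 'rV[R]_m) (y_ : nat -> 'rV[R]_m) :
  epi_cvg f_ f -> y_ @ \oo --> y ->
  epi_cvg (fun k => tilt (y_ k) (f_ k)) (tilt y f).
Proof.
move=> [flow fup] yy.
have cvg_tilt (x : 'rV[R]_m * 'rV[R]_n) (x_ : nat -> 'rV[R]_m * 'rV[R]_n) :
    x_ @ \oo --> x -> - dot (y_ k) (x_ k).1 @[k --> \oo] --> - dot y x.1.
  by move=> xx; apply: cvgN; apply: cvg_dot yy _; exact: (cvg_comp _ _ xx cvg_fst).
split=> [x x_ xx|x].
  apply: le_trans (limn_einfD_ge _ _ _ _ (cvg_tilt _ _ xx)).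
  by rewrite /tilt -EFinN leeD2r// flow.
(* The recovery sequence for [f] at [x] also serves for the tilted functions. *)
have [x_ [xx fx]] := fup x; exists x_; split=> //.
apply: le_trans (limn_esupD_le _ _ _ _ (cvg_tilt _ _ xx)) _.
by rewrite /tilt -EFinN leeD2r.
Qed.

Section Excess.
Variables (R : realType) (V : zmodType) (N : V -> R).
Hypothesis N_ge0 : forall x, 0 <= N x.
Implicit Types C D : set V.

Lemma exs_ge0 C D : (0 <= exs N C D)%E.
Proof.
rewrite /exs; case: eqP => // /eqP/set0P[x Cx]; case: ifP => // _.
apply: le_ereal_sup_tmp; exists (ereal_inf [set (N (x - y))%:E | y in D]).
  by exists x.
by apply: le_ereal_inf_tmp => _ [z _ <-]; rewrite lee_fin.
Qed.

(** Any [z] in [D'] that approximates [p x] yields the point [q z] of [D] that approximates [x]; the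
    affine bound on the distances then passes through the infimum over [z] and the supremum over
    [x]. *)
Lemma exs_transfer (p q : V -> V) (L c : R) C D C' D' :
  0 < L -> 0 <= c -> D' !=set0 ->
  (forall x, C x -> C' (p x)) -> (forall z, D' z -> D (q z)) ->
  (forall x z, C x -> D' z -> N (x - q z) <= L * N (p x - z) + c) ->
  (exs N C D <= L%:E * exs N C' D' + c%:E)%E.
Proof.
move=> L0 c0 D'0 pC qD H.
have [->|/set0P[x0 Cx0]] := eqVneq C set0.
  (* The excess of the empty set is 0 by convention, so the right side only has to be
     nonnegative. *)
  rewrite {1}/exs eqxx; apply: adde_ge0; last by rewrite lee_fin.
  by apply: mule_ge0; [rewrite lee_fin ltW|exact: exs_ge0].
have C0 : C != set0 by apply/set0P; exists x0.
have C'0 : C' != set0 by apply/set0P; exists (p x0); exact: pC.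
have D0 : D != set0 by have [z D'z] := D'0; apply/set0P; exists (q z); exact: qD.
move/set0P in D'0.
rewrite /exs (negbTE C0) (negbTE C'0) (negbTE D0) (negbTE D'0).
apply: ge_ereal_sup => _ [x Cx <-].
(* Moving [c] and [L] to the left leaves a bare supremum on the right, which is bounded below by its
   term at [p x]. *)
rewrite -leeBlDr// -lee_pdivrMl//.
apply: le_ereal_sup_tmp.
exists (ereal_inf [set (N (p x - z))%:E | z in D']).
  by exists (p x) => //; exact: pC.
apply: le_ereal_inf_tmp => _ [z D'z <-]; rewrite lee_pdivrMl// leeBlDr//.
apply: ge_ereal_inf; exists (N (x - q z))%:E; first by exists (q z) => //; exact: qD.
by rewrite -EFinM -EFinD lee_fin H.
Qed.

End Excess.

Lemma epi_norm_ge0 (R : realType) (m n : nat) (p : 'rV[R]_m * 'rV[R]_n * R) :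
  0 <= epi_norm p.
Proof. by rewrite /epi_norm le_max normr_ge0 orbT. Qed.

Lemma exs_epi_tilt_le (R : realType) (m n : nat)
    (f g : 'rV[R]_m * 'rV[R]_n -> \bar R) (y z : 'rV[R]_m) (rho rhobar : R) :
  epi g !=set0 -> 0 <= rho ->
  rho * (1 + Num.max (norm2 y) (norm2 z)) <= rhobar ->
  (exs (@epi_norm R m n) (epi (tilt y f) `&` nball (@epi_norm R m n) rho)
      (epi (tilt z g))
   <= (1 + Num.max (norm2 y) (norm2 z))%:E
        * exs (@epi_norm R m n) (epi f `&` nball (@epi_norm R m n) rhobar) (epi g)
      + (rho * norm2 (y - z))%:E)%E.
Proof.
set M := Num.max _ _ => g0 rho0 rhobarE.
have yM : norm2 y <= M by rewrite le_max lexx.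
have zM : norm2 z <= M by rewrite le_max lexx orbT.
have M0 : 0 <= M by apply: le_trans yM; exact: norm2_ge0.
have tiltE (w : 'rV[R]_m) h (x : 'rV[R]_m * 'rV[R]_n * R) :
    epi (tilt w h) x <-> epi h (x.1, x.2 + dot w x.1.1).
  by rewrite /epi /tilt /mkset leeBlDr.
(* Shear forward with [y], back with [z]. *)
apply: (@exs_transfer _ _ _ _
    (fun x => (x.1, x.2 + dot y x.1.1)) (fun x => (x.1, x.2 - dot z x.1.1))) => //.
- exact: epi_norm_ge0.
- lra.
- by rewrite mulr_ge0// norm2_ge0.
- move=> [[u x] a] [/tiltE fx]; rewrite /nball /epi_norm /= !ge_max.
  move=> /andP[/andP[hu hx] ha]; split=> //=.
  (* This settles the components [u] and [x], which the shear fixes; the last one grows to at most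
     [rho + M * rho]. *)
  have rr : rho <= rhobar.
    by apply: le_trans rhobarE; rewrite ler_peMr//; lra.
  rewrite (le_trans hu)// (le_trans hx)//=.
  apply: le_trans (ler_normD _ _) (le_trans _ rhobarE).
  rewrite mulrDr mulr1 lerD// (le_trans (normr_dot_le _ _ _ _))// mulrC.
  by rewrite ler_pM// norm2_ge0.
- by move=> [[u x] a] gx; apply/tiltE => /=; rewrite subrK.
move=> [[u x] a] [[u' x'] a'] [_]; rewrite /nball /epi_norm /= !ge_max.
move=> /andP[/andP[hu _] _] _.
(* [E] is the distance from the sheared point to the chosen point of [epi g]. *)
set E := Num.max (Num.max (norm2 (u - u')) _) _.
have uE : norm2 (u - u') <= E by rewrite !le_max lexx.
have xE : norm2 (x - x') <= E by rewrite !le_max lexx orbT.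
have aE : `|a + dot y u - a'| <= E by rewrite !le_max lexx orbT.
have E0 : 0 <= E by apply: le_trans uE; exact: norm2_ge0.
have c0 : 0 <= rho * norm2 (y - z) by rewrite mulr_ge0// norm2_ge0.
have ME : 0 <= M * E by exact: mulr_ge0.
rewrite mulrDl mul1r; apply/andP; split; first by apply/andP; split; lra.
(* The three terms are bounded by [E], [M * E] and [rho * norm2 (y - z)]. The factor [y - z] is
   paired with [u] rather than [u'], since only [u] is known to have norm at most [rho]. *)
have -> : a - (a' - dot z u') =
    (a + dot y u - a') - dot z (u - u') - dot (y - z) u.
  by rewrite dotBr dotBl; ring.
apply: le_trans (ler_normB _ _) _; apply: lerD.
  apply: le_trans (ler_normB _ _) _; apply: lerD => //.
  by rewrite (le_trans (normr_dot_le _ _ _ _))// ler_pM// norm2_ge0.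
by rewrite (le_trans (normr_dot_le _ _ _ _))// mulrC ler_wpM2r// norm2_ge0.
Qed.

Theorem theorem3p1 (R : realType) (m n : nat)
    (f : 'rV[R]_m * 'rV[R]_n -> \bar R)
    (f_ : nat -> 'rV[R]_m * 'rV[R]_n -> \bar R)
    (phi : 'rV[R]_n -> \bar R) (phi_ : nat -> 'rV[R]_n -> \bar R)
    (rock_f : rockafellian f phi)
    (rock_f_ : forall k : nat, rockafellian (f_ k) (phi_ k)) :
  (forall (y : 'rV[R]_m) (y_ : nat -> 'rV[R]_m),
     epi_cvg f_ f -> y_ @ \oo --> y ->
     epi_cvg (fun k => tilt (y_ k) (f_ k)) (tilt y f))
  /\
  (forall (k : nat) (rho rhobar : R) (y yk : 'rV[R]_m),
     epi f !=set0 -> epi (f_ k) !=set0 -> 0 <= rho ->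
     rho * (1 + Num.max (norm2 y) (norm2 yk)) <= rhobar ->
     (dhat (@epi_norm R m n) rho (epi (tilt y f)) (epi (tilt yk (f_ k)))
      <= (1 + Num.max (norm2 y) (norm2 yk))%:E
           * dhat (@epi_norm R m n) rhobar (epi f) (epi (f_ k))
         + (rho * norm2 (y - yk))%:E)%E).
Proof.
split=> [y y_|k rho rhobar y yk f0 fk0 rho0 rhobarE]; first exact: epi_cvg_tilt.
set L := 1 + _.
have L0 : (0%:E <= L%:E)%E.
  by rewrite lee_fin addr_ge0// le_max norm2_ge0.
rewrite /dhat ge_max; apply/andP; split.
  apply: le_trans (exs_epi_tilt_le _ _ _ _ _ _ _ _ _ fk0 rho0 rhobarE) _.
  by rewrite leeD2r// lee_wpmul2l// le_max lexx.
(* The second excess is the same estimate with the two functions and the two tilts exchanged; the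
   constants are symmetric in the tilts. *)
rewrite maxC in rhobarE.
apply: le_trans (exs_epi_tilt_le _ _ _ _ _ _ _ _ _ f0 rho0 rhobarE) _.
rewrite (maxC (norm2 yk)) -(opprB y) norm2N.
by rewrite leeD2r// lee_wpmul2l// le_max lexx orbT.
Qed.
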